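(* Let $\phi(\bar v)$ be an atomic $L$-formula with $\bar v=\langle v_0,\dots,v_{n-1}\rangle$. Let $M\in\mathrm{pSh}(\Omega,L)$ and let $\bar a=\langle a_0,\dots,a_{n-1}\rangle$ be a tuple of sections of $M$. Then $[\phi(\bar a)]_M=[\phi^{\exists}(\bar a)]_M$.
   Context: **Presheaves.** Fix a complete Heyting algebra $\Omega$ (top $\top$). A presheaf $M$ over $\Omega$ is a set $|M|$ of sections with maps $E:|M|\to\Omega$ (extent) and $\upharpoonright:|M|\times\Omega\to|M|$ (restriction) such that $a\upharpoonright Ea=a$, $E(a\upharpoonright p)=Ea\wedge p$, $(a\upharpoonright p)\upharpoonright q=a\upharpoonright(p\wedge q)$. Put $[a=b]_M=\bigvee\{p\le Ea\wedge Eb: a\upharpoonright p=b\upharpoonright p\}$; presheaves are extensional: $Ea=Eb=[a=b]_M$ implies $a=b$. For a tuple $\bar a$ of sections, $E\bar a=\bigwedge_iEa_i$ ($E\emptyset=\top$), $\bar a\upharpoonright p=\langle a_i\upharpoonright p\rangle_i$, $[\bar a=\bar b]_M=\bigwedge_i[a_i=b_i]_M$. **Structures.** A signature has finitary relation symbols, finitary function symbols and a presheaf over $\Omega$ of constant symbols (so each constant $c$ has an extent $Ec$). An element $M$ of $\mathrm{pSh}(\Omega,L)$ is a presheaf with: for each $n$-ary $R$ a map $R^M:|M|^n\to\Omega$ with $R^M(\bar a)\le E\bar a$ and $[\bar a=\bar b]_M\wedge R^M(\bar a)\le R^M(\bar b)$; for each $n$-ary $f$ a map $f^M:|M|^n\to|M|$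 with $Ef^M(\bar a)=E\bar a$ and $[\bar a=\bar b]_M\le[f^M(\bar a)=f^M(\bar b)]_M$; for each constant $c$ a section $\mathfrak c^M$ with $E\mathfrak c^M=Ec$, compatibly with restriction. **Interpretation.** Terms are built from variables, constants and function symbols; atomic formulae are $t_0=t_1$ and $R(t_0,\dots,t_{m-1})$. For a term or formula $\chi$, $E\chi=\bigwedge\{Ec:c\text{ occurs in }\chi\}$. For $E\bar a\le Et$: $v_i^M(\bar a)=a_i$, $c^M(\bar a)=\mathfrak c^M\upharpoonright E\bar a$, $f(t_0,\dots)^M(\bar a)=f^M(t_0^M(\bar a),\dots)$. For atomic $\phi$, with $p=E\phi$: $[(t=s)(\bar a)]_M=E(\bar a\upharpoonright p)\wedge[t^M(\bar a\upharpoonright p)=s^M(\bar a\upharpoonright p)]_M$, and $[R(t_0,\dots)(\bar a)]_M=E(\bar a\upharpoonright p)\wedge R^M(t_0^M(\bar a\upharpoonright p),\dots)$. Further $[(\psi\wedge\chi)(\bar a)]_M=E\bar a\wedge E(\psi\wedge\chi)\wedge[\psi(\bar a)]_M\wedge[\chi(\bar a)]_M$ and $[\exists x\,\psi(\bar a)]_M=E\bar a\wedge E\psi\wedge\bigvee_{s\in|M|}[\psi(s,\bar a)]_M$. **Unnesting.** An atomic formula is unnested if it is of the form $v_i=v_j$, $v_i=c$, $R(v_{i_0},\dots,v_{i_{n-1}})$ or $v_{i_n}=f(v_{i_0},\dots,v_{i_{n-1}})$, with $c$ a constant symbol (equations between a variable and a constant, or between a variable and $f$ applied to variables, count as unnested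 in either order). For atomic $\phi$ define $\phi^\exists$ recursively: $\phi^\exists=\phi$ for $\phi$ unnested. If $\phi$ is $c=d$ with $c,d$ constants, $\phi^\exists$ is $\exists v_0\,(v_0=c\wedge v_0=d)$. If $\phi$ is $f(t_0,\dots,t_{m-1})=t_m$ with not all $t_i$ variables, let $S$ be the set of $i\le m$ with $t_i$ not a variable; choose distinct new variables $x_i$ ($i\in S$) not occurring in any $t_k$, and put $x_i=t_i$ for $i\notin S$; $\phi^\exists$ is the formula obtained by prefixing $\exists x_i$, one for each $i\in S$, to the conjunction of the formulae $(x_i=t_i)^\exists$ ($i\in S$) and $f(x_0,\dots,x_{m-1})=x_m$. If $\phi$ is $t_m=f(t_0,\dots,t_{m-1})$ do the same with last conjunct $x_m=f(x_0,\dots,x_{m-1})$. If $\phi$ is $R(t_0,\dots,t_{m-1})$ with not all $t_i$ variables, do the same with $S\subseteq\{0,\dots,m-1\}$ and last conjunct $R(x_0,\dots,x_{m-1})$. *)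

(* Defs.v *)
From HB Require Import structures.
From mathcomp Require Import all_boot all_order.
From mathcomp Require Import boolp classical_sets.

Set Implicit Arguments.
Unset Strict Implicit.
Unset Printing Implicit Defensive.

Local Open Scope order_scope.

(* The finite meets and joins are those of the bounded lattice. *)
HB.mixin Record isCompleteHeyting (d : Order.disp_t) T
    of Order.TBLattice d T := {
  cjoin : set T -> T;
  cjoin_ub : forall (A : set T) x, A x -> x <= cjoin A;
  cjoin_le : forall (A : set T) y, (forall x, A x -> x <= y) -> cjoin A <= y;
  himp : T -> T -> T;
  himpP : forall x y z : T, (x <= himp y z) = (x `&` y <= z)
}.

#[short(type="completeHeytingType")]
HB.structure Definition CompleteHeyting (d : Order.disp_t) :=
  { T of isCompleteHeyting d T & Order.TBLattice d T }.

Definition raw_eqv d (Omega : completeHeytingType d) (S : Type)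
    (E : S -> Omega) (r : S -> Omega -> S) (a b : S) : Omega :=
  cjoin [set p | (p <= E a `&` E b)%O /\ r a p = r b p]%classic.

Record presheaf d (Omega : completeHeytingType d) := Presheaf {
  section :> Type;
  ext : section -> Omega;
  res : section -> Omega -> section;
  res_ext : forall a, res a (ext a) = a;
  ext_res : forall a p, ext (res a p) = ext a `&` p;
  res_res : forall a p q, res (res a p) q = res a (p `&` q);
  presheaf_extensional : forall a b,
    ext a = ext b -> ext b = raw_eqv ext res a b -> a = b
}.
Arguments ext {d Omega _}.
Arguments res {d Omega _}.

Section Tuples.
Context {d : Order.disp_t} {Omega : completeHeytingType d} {M : presheaf Omega}.
Context {n : nat}.
Implicit Types a b : 'I_n -> M.

Definition eqv (x y : M) : Omega := raw_eqv ext res x y.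
Definition text a : Omega := \meet_(i < n) ext (a i).
Definition tres a (p : Omega) : 'I_n -> M := fun i => res (a i) p.
Definition teqv a b : Omega := \meet_(i < n) eqv (a i) (b i).
Definition tcons (s : M) a : 'I_n.+1 -> M :=
  fun i => if unlift ord0 i is Some j then a j else s.

End Tuples.
Arguments eqv {d Omega M}.

Record signature d (Omega : completeHeytingType d) := Signature {
  rel_symb : Type;
  rel_ar : rel_symb -> nat;
  fun_symb : Type;
  fun_ar : fun_symb -> nat;
  const_symb : presheaf Omega
}.
Arguments rel_ar {d Omega _}.
Arguments fun_ar {d Omega _}.

Record structure d (Omega : completeHeytingType d) (L : signature Omega) :=
  Structure {
    carrier :> presheaf Omega;
    rel_int : forall R : rel_symb L, ('I_(rel_ar R) -> carrier) -> Omega;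
    fun_int : forall f : fun_symb L, ('I_(fun_ar f) -> carrier) -> carrier;
    const_int : const_symb L -> carrier;
    rel_int_ext : forall R a, @rel_int R a <= text a;
    rel_int_congr : forall R a b,
      teqv a b `&` @rel_int R a <= @rel_int R b;
    fun_int_ext : forall f a, ext (@fun_int f a) = text a;
    fun_int_congr : forall f a b,
      teqv a b <= eqv (@fun_int f a) (@fun_int f b);
    const_int_ext : forall c, ext (const_int c) = ext c;
    const_int_res : forall c p, const_int (res c p) = res (const_int c) p
  }.
Arguments rel_int {d Omega L} s R.
Arguments fun_int {d Omega L} s f.
Arguments const_int {d Omega L} s.

(* Terms and formulae are well scoped: an element of [term n], [atomic n] or
   [formula n] has its free variables among v_0, ..., v_(n-1), and [Ex psi]
   binds the variable of index 0 of psi, the other indices being shifted by 1. *)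
Section Syntax.
Context {d : Order.disp_t} {Omega : completeHeytingType d}.
Variable L : signature Omega.

Inductive term (n : nat) : Type :=
| Var (i : 'I_n)
| Cst (c : const_symb L)
| App (f : fun_symb L) (ts : 'I_(fun_ar f) -> term n).

Inductive atomic (n : nat) : Type :=
| Eq (t s : term n)
| Rel (R : rel_symb L) (ts : 'I_(rel_ar R) -> term n).

Inductive formula (n : nat) : Type :=
| Atom (phi : atomic n)
| And (psi chi : formula n)
| Ex (psi : formula n.+1).

Fixpoint rename n m (r : 'I_n -> 'I_m) (t : term n) : term m :=
  match t with
  | Var i => Var (r i)
  | Cst c => Cst m c
  | App f ts => App (fun i => rename r (ts i))
  end.

Fixpoint term_consts n (t : term n) : seq (const_symb L) :=
  match t with
  | Var _ => [::]
  | Cst c => [:: c]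
  | App f ts => flatten [seq term_consts (ts i) | i <- enum 'I_(fun_ar f)]
  end.

Definition atomic_consts n (phi : atomic n) : seq (const_symb L) :=
  match phi with
  | Eq t s => term_consts t ++ term_consts s
  | Rel R ts => flatten [seq term_consts (ts i) | i <- enum 'I_(rel_ar R)]
  end.

Fixpoint formula_consts n (phi : formula n) : seq (const_symb L) :=
  match phi with
  | Atom phi => atomic_consts phi
  | And psi chi => formula_consts psi ++ formula_consts chi
  | Ex psi => formula_consts psi
  end.

Definition atomic_ext n (phi : atomic n) : Omega :=
  \meet_(c <- atomic_consts phi) ext c.
Definition formula_ext n (phi : formula n) : Omega :=
  \meet_(c <- formula_consts phi) ext c.

End Syntax.
Arguments Var {d Omega L n}.
Arguments Cst {d Omega L n}.
Arguments App {d Omega L n}.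
Arguments Rel {d Omega L n}.

Section Interpretation.
Context {d : Order.disp_t} {Omega : completeHeytingType d}.
Context {L : signature Omega}.
Variable M : structure L.

(* Total in [a]; meaningful as t^M(a) when E a <= E t. *)
Fixpoint term_int n (t : term L n) (a : 'I_n -> M) : M :=
  match t with
  | Var i => a i
  | Cst c => res (const_int M c) (text a)
  | App f ts => fun_int M f (fun i => term_int (ts i) a)
  end.

Definition atomic_int n (phi : atomic L n) (a : 'I_n -> M) : Omega :=
  let b := tres a (atomic_ext phi) in
  match phi with
  | Eq t s => text b `&` eqv (term_int t b) (term_int s b)
  | Rel R ts => text b `&` rel_int M R (fun i => term_int (ts i) b)
  end.

Fixpoint formula_int n (phi : formula L n) : ('I_n -> M) -> Omega :=
  match phi with
  | Atom phi => atomic_int phi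
  | And psi chi => fun a =>
      text a `&` formula_ext (And psi chi)
        `&` formula_int psi a `&` formula_int chi a
  | Ex psi => fun a =>
      text a `&` formula_ext psi
        `&` cjoin (range (fun s : M => formula_int psi (tcons s a)))
  end.

End Interpretation.
Arguments term_int {d Omega L} M {n} t a.
Arguments atomic_int {d Omega L} M {n} phi a.
Arguments formula_int {d Omega L} M {n} phi a.

Section Unnesting.
Context {d : Order.disp_t} {Omega : completeHeytingType d}.
Context {L : signature Omega}.

Definition is_var n (t : term L n) : bool := if t is Var _ then true else false.

Definition all_vars n m (ts : 'I_m -> term L n) : bool :=
  [forall i, is_var (ts i)].

Definition unnested n (phi : atomic L n) : bool :=
  match phi with
  | Eq (Var _) (Var _) | Eq (Var _) (Cst _) | Eq (Cst _) (Var _) => true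
  | Eq (Var _) (App f ts) | Eq (App f ts) (Var _) => all_vars ts
  | Rel R ts => all_vars ts
  | _ => false
  end.

Fixpoint exs n k : formula L (k + n) -> formula L n :=
  match k with
  | 0 => fun psi => psi
  | k'.+1 => fun psi => @exs n k' (Ex psi)
  end.

(* For a family t_i (i < m), S = [nonvars ts] is the set of the i such that t_i
   is not a variable. The new variables are the #|S| first ones in context
   #|S| + n: the j-th element of S gets the variable of index j, and
   [args ts i] is x_i. *)
Section Args.
Context {n m : nat}.
Variable ts : 'I_m -> term L n.

Definition nonvars : {set 'I_m} := [set i | ~~ is_var (ts i)].

Definition newvar (j : 'I_#|nonvars|) : term L (#|nonvars| + n) :=
  Var (lshift n j).

Definition weaken (t : term L n) : term L (#|nonvars| + n) :=
  rename (@rshift #|nonvars| n) t.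

Definition args (i : 'I_m) : term L (#|nonvars| + n) :=
  if [pick j | enum_val j == i] is Some j then newvar j else weaken (ts i).

(* x_i = t_i for the j-th element i of S *)
Definition arg_eq (j : 'I_#|nonvars|) : atomic L (#|nonvars| + n) :=
  Eq (newvar j) (weaken (ts (enum_val j))).

Definition prefixed (psi : 'I_#|nonvars| -> formula L (#|nonvars| + n))
    (last : atomic L (#|nonvars| + n)) : formula L n :=
  exs (foldr (fun j chi => And (psi j) chi) (Atom last) (enum 'I_#|nonvars|)).

End Args.
Arguments arg_eq {n m} ts j.
Arguments prefixed {n m} ts psi last.

Definition tsnoc n m (ts : 'I_m -> term L n) (t : term L n) :
    'I_m.+1 -> term L n :=
  fun i => if unlift ord_max i is Some j then ts j else t.
Definition tinit n m (ts : 'I_m.+1 -> term L n) : 'I_m -> term L n :=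
  fun i => ts (lift ord_max i).
Definition tlast n m (ts : 'I_m.+1 -> term L n) : term L n := ts ord_max.

(* [unnesting phi psi]: psi is phi^exists. This is a relation because both the
   clause [unnesting_fun_l] and the clause [unnesting_fun_r] apply to an
   equation f(...) = g(...). See [unnesting_total]. *)
Inductive unnesting : forall n, atomic L n -> formula L n -> Prop :=
| unnesting_unnested n (phi : atomic L n) :
    unnested phi -> unnesting phi (Atom phi)
| unnesting_const n (b c : const_symb L) :
    unnesting (Eq (Cst b) (Cst c) : atomic L n)
      (Ex (And (Atom (Eq (Var ord0) (Cst b))) (Atom (Eq (Var ord0) (Cst c)))))
| unnesting_fun_l n (f : fun_symb L) (ts : 'I_(fun_ar f) -> term L n) (t : term L n) psi :
    let us := tsnoc ts t in
    ~~ all_vars us ->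
    (forall j, unnesting (arg_eq us j) (psi j)) ->
    unnesting (Eq (App f ts) t)
      (prefixed us psi (Eq (App f (tinit (args us))) (tlast (args us))))
| unnesting_fun_r n (f : fun_symb L) (ts : 'I_(fun_ar f) -> term L n) (t : term L n) psi :
    let us := tsnoc ts t in
    ~~ all_vars us ->
    (forall j, unnesting (arg_eq us j) (psi j)) ->
    unnesting (Eq t (App f ts))
      (prefixed us psi (Eq (tlast (args us)) (App f (tinit (args us)))))
| unnesting_rel n (R : rel_symb L) (ts : 'I_(rel_ar R) -> term L n) psi :
    ~~ all_vars ts ->
    (forall j, unnesting (arg_eq ts j) (psi j)) ->
    unnesting (Rel R ts) (prefixed ts psi (Rel R (args ts))).

Lemma rename_comp n m p (r : 'I_n -> 'I_m) (s : 'I_m -> 'I_p) (t : term L n) :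
  rename s (rename r t) = rename (s \o r) t.
Proof.
elim: t => //= f ts IH; congr (App f _); apply/funext => i; exact: IH.
Qed.

Lemma tsnoc_lift n m (ts : 'I_m -> term L n) t i :
  tsnoc ts t (lift ord_max i) = ts i.
Proof. by rewrite /tsnoc liftK. Qed.

Lemma tsnoc_max n m (ts : 'I_m -> term L n) t : tsnoc ts t ord_max = t.
Proof. by rewrite /tsnoc unlift_none. Qed.

Lemma all_vars_tsnoc n m (ts : 'I_m -> term L n) t :
  all_vars (tsnoc ts t) = all_vars ts && is_var t.
Proof.
apply/forallP/andP => [h|[/forallP h ht] i].
  split; last by rewrite -(tsnoc_max ts t).
  by apply/forallP => i; rewrite -(tsnoc_lift ts t).
by case: (unliftP ord_max i) => [j|] ->; rewrite ?tsnoc_lift ?tsnoc_max.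
Qed.

Lemma unnesting_var_total n (t : term L n) m (r : 'I_n -> 'I_m) x :
  exists psi, unnesting (Eq (Var x) (rename r t)) psi.
Proof.
elim: t m r x => [i|c|f ts IH] m r x /=; try by eexists; exact: unnesting_unnested.
case: (boolP (all_vars (tsnoc (fun i => rename r (ts i)) (Var x)))) => [h|h].
  eexists; apply: unnesting_unnested => /=.
  by move: h; rewrite all_vars_tsnoc => /andP[].
set us := tsnoc _ _ in h.
have /choice[psi psiP] j : exists psi, unnesting (arg_eq us j) psi.
  rewrite /arg_eq /weaken; move: (enum_valP j); rewrite inE.
  move: (enum_val j) => i; case: (unliftP ord_max i) => [i'|] ->.
    by rewrite /us tsnoc_lift rename_comp => _; exact: IH.
  by rewrite /us tsnoc_max.
by eexists; apply: (unnesting_fun_r h psiP).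
Qed.

Lemma unnesting_total n (phi : atomic L n) : exists psi, unnesting phi psi.
Proof.
have H m (ts : 'I_m -> term L n) : exists psi, forall j, unnesting (arg_eq ts j) (psi j).
  by have /choice[psi psiP] j := unnesting_var_total (ts (enum_val j)) (@rshift #|nonvars ts| n) (lshift n j); exists psi.
have Hfun_l f us t : exists psi, unnesting (Eq (App f us) t : atomic L n) psi.
  case: (boolP (all_vars (tsnoc us t))) => h; last first.
    have [psi psiP] := H _ (tsnoc us t).
    by eexists; apply: (unnesting_fun_l h psiP).
  eexists; apply: unnesting_unnested; move: h; rewrite all_vars_tsnoc => /andP[].
  by case: t.
have Hfun_r f us t : exists psi, unnesting (Eq t (App f us) : atomic L n) psi.
  case: (boolP (all_vars (tsnoc us t))) => h; last first.
    have [psi psiP] := H _ (tsnoc us t).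
    by eexists; apply: (unnesting_fun_r h psiP).
  eexists; apply: unnesting_unnested; move: h; rewrite all_vars_tsnoc => /andP[].
  by case: t.
case: phi => [[i|c|f ts] [j|c'|g us]|R ts];
  try (by [exact: Hfun_l | exact: Hfun_r]);
  try (by eexists; exact: unnesting_unnested).
  by eexists; exact: unnesting_const.
case: (boolP (all_vars ts)) => h; first by eexists; exact: unnesting_unnested.
by have [psi psiP] := H _ ts; eexists; apply: (unnesting_rel h psiP).
Qed.

End Unnesting.

(* Main.v *)
(* Restricting two sections to the extent of their equality identifies them, so
   [x <= [a = b]] says that x lies below both extents and a, b have the same
   restriction to x. Compared through their lower bounds x, both sides of the
   theorem become ordinary first order statements "at stage x". There the new
   variables of [phi_ex] are forced to take the values t_i^M(a), which are
   themselves witnesses, since their extent lies above that of a and t_i. *)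
Require Import Defs.
From mathcomp Require Import all_boot all_order.
From mathcomp Require Import boolp classical_sets.

Set Implicit Arguments.
Unset Strict Implicit.
Unset Printing Implicit Defensive.

Import Order.LTheory.

Local Open Scope order_scope.

(** * Equality of sections and tuples at a stage [x] *)

Section Equality.
Context {d : Order.disp_t} {Omega : completeHeytingType d} {M : presheaf Omega}.
Implicit Types (a b c : M) (x : Omega).

Lemma eqv_le_ext a b : eqv a b <= ext a `&` ext b.
Proof. by apply: cjoin_le => p []. Qed.

(** By extensionality it is enough that both restrictions have extent [eqv a b] and are equal to
    exactly that degree. Every [p] in the join defining [eqv a b] lies below it, so restricting to
    [eqv a b] first changes nothing on [p]. *)
Lemma res_eqv a b : res a (eqv a b) = res b (eqv a b).
Proof.
have := eqv_le_ext a b; rewrite lexI => /andP[lea leb].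
have exta : ext (res a (eqv a b)) = eqv a b by rewrite ext_res; apply/meet_idPr.
have extb : ext (res b (eqv a b)) = eqv a b by rewrite ext_res; apply/meet_idPr.
apply: presheaf_extensional; rewrite ?exta ?extb //.
apply/le_anti/andP; split; last first.
  by apply: cjoin_le => p []; rewrite exta extb meetxx.
apply: cjoin_le => p pP; apply: cjoin_ub.
have le_p : p <= eqv a b by apply: cjoin_ub.
split; first by rewrite exta extb meetxx.
by rewrite !res_res (meet_idPr le_p); case: pP.
Qed.

(** Forward, [res_eqv] is restricted further from [eqv a b] to [x]; backward, [x] is a member of the
    join. *)
Lemma le_eqv x a b :
  x <= eqv a b <-> [/\ x <= ext a, x <= ext b & res a x = res b x].
Proof.
split=> [xab|[xa xb abx]]; last by apply: cjoin_ub; rewrite /= lexI xa xb.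
have := le_trans xab (eqv_le_ext a b); rewrite lexI => /andP[xa xb].
by split=> //; rewrite -(meet_idPr xab) -!res_res res_eqv.
Qed.

Lemma le_eqv_refl x a : (x <= eqv a a) = (x <= ext a).
Proof. by apply/idP/idP => [/le_eqv[]|xa] //; apply/le_eqv. Qed.

Lemma eqvC a b : eqv a b = eqv b a.
Proof.
by apply/le_anti/andP; split; apply/le_eqv;
  have /le_eqv[] := lexx (eqv a b); have /le_eqv[] := lexx (eqv b a).
Qed.

Lemma le_eqv_trans x b a c : x <= eqv a b -> x <= eqv b c -> x <= eqv a c.
Proof.
by move=> /le_eqv[xa _ eab] /le_eqv[_ xc ebc]; apply/le_eqv; rewrite eab ebc.
Qed.

(** A constant is interpreted by one section restricted to the extent of the current tuple, so
    changing the tuple only changes [p] to [q], which is invisible below both. *)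
Lemma le_eqv_res x a p q : x <= ext a -> x <= p -> x <= q ->
  x <= eqv (res a p) (res a q).
Proof.
move=> xa xp xq; apply/le_eqv; rewrite !ext_res !lexI xa xp xq.
by rewrite !res_res (meet_idPr xp) (meet_idPr xq).
Qed.

Lemma le_text n (a : 'I_n -> M) x :
  x <= text a <-> forall i, x <= ext (a i).
Proof. by split=> [/meetsP xa i|xa]; [exact: xa|apply/meetsP]. Qed.

Lemma le_teqv n (a b : 'I_n -> M) x :
  x <= teqv a b <-> forall i, x <= eqv (a i) (b i).
Proof. by split=> [/meetsP xab i|xab]; [exact: xab|apply/meetsP]. Qed.

Lemma text_tres n (a : 'I_n -> M) p x :
  x <= text a -> x <= p -> x <= text (tres a p).
Proof. by move=> /le_text xa xp; apply/le_text => i; rewrite ext_res lexI xa. Qed.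

Lemma le_eqv_tres n (a : 'I_n -> M) p x i :
  x <= text (tres a p) -> x <= eqv (a i) (tres a p i).
Proof.
move=> /le_text/(_ i); rewrite ext_res lexI => /andP[xa xp].
(* [a i] is itself a restriction, namely to its own extent. *)
by rewrite -{1}[a i]res_ext; apply: le_eqv_res.
Qed.

Lemma le_text_eqv n (a b : 'I_n -> M) x :
  (forall i, x <= eqv (a i) (b i)) -> x <= text b.
Proof. by move=> xab; apply/le_text => i; have /le_eqv[] := xab i. Qed.

Lemma tcons0 n s (a : 'I_n -> M) : tcons s a ord0 = s.
Proof. by rewrite /tcons unlift_none. Qed.

Lemma le_text_tcons n s (a : 'I_n -> M) x :
  x <= text (tcons s a) <-> x <= ext s /\ x <= text a.
Proof.
split=> [/le_text xsa|[xs /le_text xa]].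
  split; first by rewrite -(tcons0 s a).
  by apply/le_text => i; have := xsa (lift ord0 i); rewrite /tcons liftK.
by apply/le_text => i; rewrite /tcons; case: unliftP.
Qed.

End Equality.

(** The Yoneda principle for posets; it turns equalities of truth values into equivalences at every
    stage. *)
Lemma eq_lower d (T : porderType d) (y z : T) :
  (forall x, x <= y <-> x <= z) -> y = z.
Proof. by move=> yz; apply/le_anti; apply/andP; split; apply/yz. Qed.

(** * Extents of terms and formulae, and renaming *)

Section Extents.
Context {d : Order.disp_t} {Omega : completeHeytingType d}.
Context {L : signature Omega}.
Implicit Types x : Omega.

Definition term_ext n (t : term L n) : Omega :=
  \meet_(c <- term_consts t) ext c.

(** Serves function terms and relational atoms alike, since both concatenate the constants of their
    arguments. *)
Lemma le_meet_flatten m (s : 'I_m -> seq (const_symb L)) x :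
  x <= \meet_(c <- flatten [seq s i | i <- enum 'I_m]) ext c <->
  forall i, x <= \meet_(c <- s i) ext c.
Proof.
rewrite big_flatten big_map big_enum.
by split=> [/meetsP xs i|xs]; [exact: xs|apply/meetsP].
Qed.

Lemma le_term_ext_App n f (ts : 'I_(fun_ar f) -> term L n) x :
  x <= term_ext (App f ts) <-> forall i, x <= term_ext (ts i).
Proof. exact: le_meet_flatten. Qed.

Lemma le_atomic_ext_Rel n R (ts : 'I_(rel_ar R) -> term L n) x :
  x <= atomic_ext (Rel R ts) <-> forall i, x <= term_ext (ts i).
Proof. exact: le_meet_flatten. Qed.

Lemma atomic_ext_Eq n (t s : term L n) :
  atomic_ext (Eq t s) = term_ext t `&` term_ext s.
Proof. exact: big_cat. Qed.

Lemma formula_ext_And n (psi chi : formula L n) :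
  formula_ext (And psi chi) = formula_ext psi `&` formula_ext chi.
Proof. exact: big_cat. Qed.

Lemma term_ext_Var n i : term_ext (Var i : term L n) = \top.
Proof. exact: big_nil. Qed.

Lemma term_ext_Cst n c : term_ext (Cst c : term L n) = ext c.
Proof. exact: big_seq1. Qed.

Lemma term_consts_rename n m (r : 'I_n -> 'I_m) (t : term L n) :
  term_consts (rename r t) = term_consts t.
Proof. by elim: t => //= f ts IH; congr flatten; apply: eq_map. Qed.

Lemma term_ext_rename n m (r : 'I_n -> 'I_m) (t : term L n) :
  term_ext (rename r t) = term_ext t.
Proof. by rewrite /term_ext term_consts_rename. Qed.

Lemma rename_id n (t : term L n) : rename id t = t.
Proof. by elim: t => //= f ts IH; congr (App f _); apply/funext. Qed.

End Extents.

(** * Values of terms and atomic formulae at a stage *)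

Section Interpretation.
Context {d : Order.disp_t} {Omega : completeHeytingType d}.
Context {L : signature Omega} {M : structure L}.
Implicit Types x : Omega.

Lemma le_ext_term_int n (t : term L n) (a : 'I_n -> M) x :
  x <= text a -> x <= term_ext t -> x <= ext (term_int M t a).
Proof.
move=> xa; elim: t => [i|c|f ts IH] /=.
- by move=> _; move/le_text: xa; apply.
- by rewrite term_ext_Cst ext_res const_int_ext lexI xa => ->.
- move=> /le_term_ext_App xts; rewrite fun_int_ext; apply/le_text => i.
  exact: IH.
Qed.

(** Function symbols preserve extents, so a value defined at [x] has all its arguments defined at
    [x], down to the constants. Extent conditions can thus be read off from the truth of an atomic
    formula. *)
Lemma ext_term_int_le n (t : term L n) (a : 'I_n -> M) x :
  x <= ext (term_int M t a) -> x <= term_ext t.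
Proof.
elim: t => [i|c|f ts IH] /=.
- by rewrite term_ext_Var lex1.
- by rewrite term_ext_Cst ext_res const_int_ext lexI => /andP[].
- rewrite fun_int_ext => /le_text xts; apply/le_term_ext_App => i.
  exact: IH.
Qed.

Lemma fun_int_eqv f (a b : 'I_(fun_ar f) -> M) x :
  (forall i, x <= eqv (a i) (b i)) -> x <= eqv (fun_int M f a) (fun_int M f b).
Proof. by move=> xab; apply: le_trans (fun_int_congr a b); apply/le_teqv. Qed.

Lemma rel_int_eqv R (a b : 'I_(rel_ar R) -> M) x :
  (forall i, x <= eqv (a i) (b i)) -> x <= rel_int M R a -> x <= rel_int M R b.
Proof.
move=> xab xa; apply: le_trans (rel_int_congr a b); rewrite lexI xa andbT.
exact/le_teqv.
Qed.

(** Variables agree by hypothesis and function symbols are congruences. Constants are the delicate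
    case: they are cut down to the extents of [a] and [b], which may differ, but both lie above
    [x]. *)
Lemma term_int_rename n m (r : 'I_n -> 'I_m) (t : term L n)
    (a : 'I_n -> M) (b : 'I_m -> M) x :
  x <= text b -> x <= term_ext t -> (forall i, x <= eqv (b (r i)) (a i)) ->
  x <= eqv (term_int M (rename r t) b) (term_int M t a).
Proof.
move=> xb xt xba; elim: t xt => [i|c|f ts IH] /= => [_|xc|].
- exact: xba.
- rewrite term_ext_Cst in xc; apply: le_eqv_res; rewrite ?const_int_ext //.
  exact: le_text_eqv xba.
- by move=> /le_term_ext_App xts; apply: fun_int_eqv => i; exact: IH.
Qed.

Lemma term_int_eqv n (t : term L n) (a b : 'I_n -> M) x :
  x <= text a -> x <= term_ext t -> (forall i, x <= eqv (a i) (b i)) ->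
  x <= eqv (term_int M t a) (term_int M t b).
Proof. by move=> xa xt xab; rewrite -{1}[t]rename_id; apply: term_int_rename. Qed.

Lemma le_text_of_tres n (a : 'I_n -> M) p x :
  x <= text (tres a p) -> x <= text a.
Proof.
move=> /le_text xa; apply/le_text => i; have := xa i.
by rewrite ext_res lexI => /andP[].
Qed.

(* The restriction of [a] to the extent of the formula is irrelevant. *)
Lemma le_atomic_int_Eq n (t s : term L n) (a : 'I_n -> M) x :
  x <= atomic_int M (Eq t s) a <->
  [/\ x <= text a, x <= term_ext t, x <= term_ext s
    & x <= eqv (term_int M t a) (term_int M s a)].
Proof.
rewrite /atomic_int lexI; split=> [/andP[xb xts]|[xa xt xs xts]].
  have [/ext_term_int_le xt /ext_term_int_le xs _] := (le_eqv _ _ _).1 xts.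
  have xa := le_text_of_tres xb; split=> //.
  have xab i := le_eqv_tres i xb.
  apply: le_eqv_trans (term_int_eqv xa xt xab) _.
  by apply: le_eqv_trans xts _; rewrite eqvC term_int_eqv.
have xb : x <= text (tres a (atomic_ext (Eq t s))).
  by apply: text_tres; rewrite // atomic_ext_Eq lexI xt.
have xab i := le_eqv_tres i xb; rewrite xb /=.
apply: le_eqv_trans (_ : _ <= eqv _ (term_int M t a)) _.
  by rewrite eqvC term_int_eqv.
by apply: le_eqv_trans xts _; rewrite term_int_eqv.
Qed.

Lemma le_atomic_int_Rel n R (ts : 'I_(rel_ar R) -> term L n) (a : 'I_n -> M) x :
  x <= atomic_int M (Rel R ts) a <->
  [/\ x <= text a, forall i, x <= term_ext (ts i)
    & x <= rel_int M R (fun i => term_int M (ts i) a)].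
Proof.
rewrite /atomic_int lexI; split=> [/andP[xb xR]|[xa xts xR]].
  have xts i : x <= term_ext (ts i).
    (* The truth value of [R] lies below the extents of its arguments, so each of them is defined at
       [x]. *)
    have /le_text/(_ i) := le_trans xR (rel_int_ext _).
    exact: ext_term_int_le.
  have xa := le_text_of_tres xb; split=> //.
  apply: rel_int_eqv xR => i; rewrite eqvC; apply: term_int_eqv => // k.
  exact: le_eqv_tres.
have xb : x <= text (tres a (atomic_ext (Rel R ts))).
  by apply: text_tres => //; apply/le_atomic_ext_Rel.
rewrite xb /=; apply: rel_int_eqv xR => i; apply: term_int_eqv => // k.
exact: le_eqv_tres.
Qed.

(** * Conjunctions and blocks of existential quantifiers *)

Lemma atomic_int_le n (phi : atomic L n) (a : 'I_n -> M) :
  atomic_int M phi a <= text a `&` atomic_ext phi.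
Proof.
suff le_x x : x <= atomic_int M phi a -> x <= text a `&` atomic_ext phi.
  exact: le_x.
case: phi => [t s|R ts].
  by move=> /le_atomic_int_Eq[xa xt xs _]; rewrite lexI xa atomic_ext_Eq lexI xt.
by move=> /le_atomic_int_Rel[xa xts _]; rewrite lexI xa; apply/le_atomic_ext_Rel.
Qed.

(** Truth at a stage entails definedness there; with this the clauses for [And] and [Ex] become a
    plain meet and a plain join. *)
Lemma formula_int_le n (phi : formula L n) (a : 'I_n -> M) :
  formula_int M phi a <= text a `&` formula_ext phi.
Proof.
case: phi => [phi|psi chi|psi] /=; first exact: atomic_int_le.
  by rewrite -!meetA lexI leIl leIxr // leIl.
exact: leIl.
Qed.

Lemma formula_int_And n (psi chi : formula L n) (a : 'I_n -> M) :
  formula_int M (And psi chi) a = formula_int M psi a `&` formula_int M chi a.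
Proof.
rewrite /= formula_ext_And -!meetA; apply: eq_lower => x; rewrite !lexI.
split=> [/and5P[_ _ _ -> ->] //|/andP[xpsi xchi]]; rewrite xpsi xchi.
have := le_trans xpsi (formula_int_le _ _); rewrite lexI => /andP[-> ->].
by have := le_trans xchi (formula_int_le _ _); rewrite lexI => /andP[_ ->].
Qed.

Lemma formula_int_Ex n (psi : formula L n.+1) (a : 'I_n -> M) :
  formula_int M (Ex psi) a =
  cjoin (range (fun s : M => formula_int M psi (tcons s a))).
Proof.
apply/meet_idPr; apply: cjoin_le => _ [s _ <-].
apply: le_trans (formula_int_le _ _) _; rewrite lexI leIr andbT.
by have := leIl (text (tcons s a)) (formula_ext psi) => /le_text_tcons[].
Qed.

(** Lets a whole block of quantifiers be witnessed at once, by a tuple extending [a]. The induction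
    generalises [psi], because [exs] binds the variable of index 0 first and continues with
    [Ex psi]. *)
Lemma formula_int_exs n k (psi : formula L (k + n)) (a : 'I_n -> M) :
  formula_int M (exs psi) a =
  cjoin [set formula_int M psi b |
          b in [set b : 'I_(k + n) -> M | forall i, b (rshift k i) = a i]]%classic.
Proof.
elim: k psi => [|k IH] psi /=.
  have rshift0 i : rshift 0 i = i :> 'I_n by apply: val_inj.
  apply/le_anti/andP; split.
    by apply: cjoin_ub; exists a => //= i; rewrite rshift0.
  apply: cjoin_le => _ [b ba <-]; suff -> : b = a by [].
  by apply/funext => i; rewrite -ba rshift0.
rewrite IH; apply/le_anti/andP; split; apply: cjoin_le.
  move=> _ [b ba <-]; rewrite formula_int_Ex; apply: cjoin_le => _ [s _ <-].
  apply: cjoin_ub; exists (tcons s b) => //= i.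
  by rewrite -ba /tcons (_ : rshift k.+1 i = lift ord0 (rshift k i)) ?liftK //;
    apply: val_inj.
(* The head of [b] witnesses the innermost quantifier, and its tail [b'] still extends [a]. *)
move=> _ [b ba <-]; pose b' i := b (lift ord0 i).
have -> : b = tcons (b ord0) b'.
  by apply/funext => i; rewrite /tcons; case: unliftP => [j|] ->.
apply: (@le_trans _ _ (formula_int M (Ex psi) b')).
  by rewrite formula_int_Ex; apply: cjoin_ub; exists (b ord0).
apply: cjoin_ub; exists b' => //= i; rewrite -ba /b'; congr b.
exact: val_inj.
Qed.

Lemma formula_int_foldr_And n (I : eqType) (s : seq I) (psi : I -> formula L n)
    (chi : formula L n) (a : 'I_n -> M) x :
  x <= formula_int M (foldr (fun j => And (psi j)) chi s) a <->
  (forall j, j \in s -> x <= formula_int M (psi j) a) /\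
  x <= formula_int M chi a.
Proof.
elim: s => [|j s IH]; first by split=> [|[]].
rewrite [foldr _ _ _]/= formula_int_And lexI; split.
  move=> /andP[xj /IH[xs xchi]]; split=> // k.
  by rewrite inE => /predU1P[->|/xs].
move=> [xs xchi]; rewrite xs ?mem_head //=; apply/IH; split=> // k ks.
by rewrite xs // inE ks orbT.
Qed.

(* Lets relations and both kinds of equations f(...) = t and t = f(...) be
   treated at once. *)
Definition reads n m (core : ('I_m -> M) -> Omega) (phi : atomic L n)
    (us : 'I_m -> term L n) :=
  forall (a : 'I_n -> M) x, x <= atomic_int M phi a <->
  [/\ x <= text a, forall i, x <= term_ext (us i)
    & x <= core (fun i => term_int M (us i) a)].

Lemma reads_Rel n R (ts : 'I_(rel_ar R) -> term L n) :
  reads (rel_int M R) (Rel R ts) ts.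
Proof. by move=> a x; apply: le_atomic_int_Rel. Qed.

(** The graph of [f] as an $\Omega$-valued predicate, with the value in the last place as in
    [tsnoc]. It is to equations what [rel_int] is to relational atoms. *)
Definition fun_graph f (u : 'I_(fun_ar f).+1 -> M) : Omega :=
  eqv (fun_int M f (fun i => u (lift ord_max i))) (u ord_max).

Lemma reads_fun_l n f (us : 'I_(fun_ar f).+1 -> term L n) :
  reads (@fun_graph f) (Eq (App f (tinit us)) (tlast us)) us.
Proof.
move=> a x; split=> [/le_atomic_int_Eq[xa /le_term_ext_App xus xu xf]|].
  by split=> // i; case: (unliftP ord_max i) => [j|] ->; rewrite ?xus.
move=> [xa xus xf]; apply/le_atomic_int_Eq; split=> //; last exact: xus.
by apply/le_term_ext_App => i; apply: xus.
Qed.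

Lemma atomic_int_EqC n (t s : term L n) (a : 'I_n -> M) :
  atomic_int M (Eq t s) a = atomic_int M (Eq s t) a.
Proof.
by apply: eq_lower => x; split=> /le_atomic_int_Eq[? ? ? ?];
  apply/le_atomic_int_Eq; split; rewrite 1?eqvC.
Qed.

Lemma reads_fun_r n f (us : 'I_(fun_ar f).+1 -> term L n) :
  reads (@fun_graph f) (Eq (tlast us) (App f (tinit us))) us.
Proof. by move=> a x; rewrite atomic_int_EqC; apply: reads_fun_l. Qed.

Lemma fun_graph_eqv f (u v : 'I_(fun_ar f).+1 -> M) x :
  (forall i, x <= eqv (u i) (v i)) -> x <= fun_graph u -> x <= fun_graph v.
Proof.
move=> xuv xu; apply: le_eqv_trans (xuv ord_max).
apply: le_eqv_trans xu; rewrite eqvC; apply: fun_int_eqv => i; exact: xuv.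
Qed.

End Interpretation.

(** * The existential prefix of the recursive clauses *)

Section Prefix.
Context {d : Order.disp_t} {Omega : completeHeytingType d}.
Context {L : signature Omega} {M : structure L}.
Context {n m : nat}.
Variable ts : 'I_m -> term L n.
Implicit Types x : Omega.

(** Stated as an inductive specification so that one case analysis replaces [args ts i] and also
    yields what is known about [i] or [ts i]. *)
Variant args_spec (i : 'I_m) : term L (#|nonvars ts| + n) -> Prop :=
| ArgsNew j of enum_val j = i : args_spec i (newvar j)
| ArgsVar k of ts i = Var k : args_spec i (Var (rshift _ k)).

Lemma argsP i : args_spec i (args ts i).
Proof.
rewrite /args; case: pickP => [j /eqP ji|nj]; first exact: ArgsNew.
(* Otherwise the rank of [i] in [nonvars ts] would have been picked. *)
have : i \notin nonvars ts.
  apply/negP => iN; have := nj (enum_rank_in iN i).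
  by rewrite enum_rankK_in // eqxx.
by rewrite inE negbK /weaken; case E: (ts i) => [k| |] // _; exact: ArgsVar.
Qed.

(** The inductive step common to the three recursive clauses. The conjuncts $x_i=t_i$ make each new
    variable equal, at the stage considered, to $t_i^M(\bar a)$; as [core] respects equality, it can
    be transported between the $x_i$ and the $t_i$. *)
Lemma formula_int_prefixed (core : ('I_m -> M) -> Omega) phi last
    (psi : 'I_#|nonvars ts| -> formula L (#|nonvars ts| + n)) (a : 'I_n -> M) :
  (forall u v x, (forall i, x <= eqv (u i) (v i)) ->
    x <= core u -> x <= core v) ->
  reads core phi ts -> reads core last (args ts) ->
  (forall j (b : 'I_(#|nonvars ts| + n) -> M),
    atomic_int M (arg_eq j) b = formula_int M (psi j) b) ->
  atomic_int M phi a = formula_int M (prefixed psi last) a.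
Proof.
move=> core_eqv phiE lastE psiE; rewrite formula_int_exs.
(* Shared by both directions: old variables take their values from [a], so only the new ones have to
   be checked. *)
have args_eqv b x : (forall i, b (rshift _ i) = a i) -> x <= text b ->
    (forall j, x <= term_ext (ts (enum_val j)) /\
       x <= eqv (b (lshift n j)) (term_int M (ts (enum_val j)) a)) ->
    forall i, x <= term_ext (ts i) /\
      x <= eqv (term_int M (args ts i) b) (term_int M (ts i) a).
  move=> ba /le_text xb xbt i; case: argsP => [j <-|k ->] //=.
  by rewrite term_ext_Var lex1 ba le_eqv_refl -ba.
have text_ext b x : (forall i, b (rshift _ i) = a i) -> x <= text b -> x <= text a.
  by move=> ba /le_text xb; apply/le_text => i; rewrite -ba.
(* Weakened terms mention no new variable, so renaming along [rshift] applies. *)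
have weaken_eqv b x j : (forall i, b (rshift _ i) = a i) -> x <= text b ->
    x <= term_ext (ts (enum_val j)) ->
    x <= eqv (term_int M (weaken ts (ts (enum_val j))) b)
             (term_int M (ts (enum_val j)) a).
  move=> ba xb xt; apply: term_int_rename => // i; rewrite ba le_eqv_refl.
  by move: i; apply/le_text; apply: text_ext xb.
apply/le_anti/andP; split; last first.
  (* Right to left: for a tuple [b] of witnesses, the truth value of the body at [b] serves as the
     stage [x]. *)
  apply: cjoin_le => _ [b ba <-].
  set x := formula_int _ _ _; have := lexx x; rewrite {2}/x.
  move=> /formula_int_foldr_And[xpsi /lastE[xb _ xcore]].
  have xts : forall i, x <= term_ext (ts i) /\
      x <= eqv (term_int M (args ts i) b) (term_int M (ts i) a).
    apply: args_eqv => // j.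
    have := xpsi j (mem_enum _ _); rewrite -psiE => /le_atomic_int_Eq[_ _].
    rewrite term_ext_rename => xt xj; split=> //.
    (* The new variable equals $t_j$ evaluated at [b], which equals $t_j$ evaluated at [a]. *)
    by apply: le_eqv_trans xj _; apply: weaken_eqv.
  apply/phiE; split=> [|i|]; [exact: text_ext xb|by case: (xts i)|].
  by apply: core_eqv xcore => i; case: (xts i).
set x := atomic_int _ _ _; have := lexx x; rewrite {2}/x => /phiE[xa xts xcore].
(* Left to right: the new positions get the values $t_j^M(\bar a)$, whose extents lie above [x], and
   the old ones keep $\bar a$. *)
pose b (i : 'I_(#|nonvars ts| + n)) : M :=
  match split i with
  | inl j => term_int M (ts (enum_val j)) a
  | inr i => a i
  end.
have bl j : b (lshift n j) = term_int M (ts (enum_val j)) a.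
  by rewrite /b (unsplitK (inl j)).
have br i : b (rshift _ i) = a i by rewrite /b (unsplitK (inr i)).
have xj j : x <= ext (term_int M (ts (enum_val j)) a) by apply: le_ext_term_int.
have xb : x <= text b.
  by apply/le_text => i; rewrite /b; case: split => // k; move/le_text: xa; apply.
apply: (@le_trans _ _ (formula_int M
  (foldr (fun j => And (psi j)) (Atom last) (enum 'I_#|nonvars ts|)) b)); last first.
  by apply: cjoin_ub; exists b.
apply/formula_int_foldr_And; split=> [j _|].
  rewrite -psiE; apply/le_atomic_int_Eq; split=> //.
  - by rewrite term_ext_Var lex1.
  - by rewrite term_ext_rename.
  - by rewrite /= bl eqvC; apply: weaken_eqv.
apply/lastE; split=> // [i|].
  by case: argsP => *; rewrite term_ext_Var lex1.
apply: core_eqv xcore => i; rewrite eqvC.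
have xargs := @args_eqv b x br xb.
by case: (xargs _ i) => // j; rewrite bl le_eqv_refl.
Qed.

End Prefix.

(** * Equations between two constants *)

Lemma atomic_int_const d (Omega : completeHeytingType d) (L : signature Omega)
    (M : structure L) n (b c : const_symb L) (a : 'I_n -> M) :
  atomic_int M (Eq (Cst b) (Cst c)) a =
  formula_int M
    (Ex (And (Atom (Eq (Var ord0) (Cst b))) (Atom (Eq (Var ord0) (Cst c))))) a.
Proof.
rewrite formula_int_Ex; apply/le_anti/andP; split; last first.
  apply: cjoin_le => _ [s _ <-]; rewrite formula_int_And.
  set x := _ `&` _; have := lexx x; rewrite {2}/x lexI => /andP[].
  move=> /le_atomic_int_Eq[/le_text_tcons[xs xa] _ xb xsb].
  move=> /le_atomic_int_Eq[xsa _ xc xsc].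
  apply/le_atomic_int_Eq; split=> //.
  rewrite term_ext_Cst in xb; rewrite term_ext_Cst in xc.
  (* The chain goes from [b] at [a] to [b] at [tcons s a], to [s], to [c] at [tcons s a], to [c] at
     [a]; the outer links only change the extent to which a constant is restricted. *)
  apply: (@le_eqv_trans _ _ _ _ (term_int M (Cst b) (tcons s a))).
    by apply: le_eqv_res; rewrite ?const_int_ext.
  apply: (@le_eqv_trans _ _ _ _ s).
    by move: xsb; rewrite eqvC /= tcons0.
  apply: (@le_eqv_trans _ _ _ _ (term_int M (Cst c) (tcons s a))).
    by move: xsc; rewrite /= tcons0.
  by apply: le_eqv_res; rewrite ?const_int_ext.
set x := atomic_int _ _ _; have := lexx x.
rewrite {2}/x => /le_atomic_int_Eq[xa xb xc xbc].
(* The value of [b] is the witness; at [x] it equals that of [c], so it satisfies both conjuncts. *)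
pose s := term_int M (Cst b) a.
apply: (@le_trans _ _ (formula_int M (And (Atom (Eq (Var ord0) (Cst b)))
  (Atom (Eq (Var ord0) (Cst c)))) (tcons s a))); last first.
  by apply: cjoin_ub; exists s.
have xsa : x <= text (tcons s a).
  by apply/le_text_tcons; split=> //; apply: le_ext_term_int.
have xcst e : x <= term_ext (Cst e : term L n) ->
    x <= eqv (term_int M (Cst e) a) (term_int M (Cst e) (tcons s a)).
  by rewrite term_ext_Cst => xe; apply: le_eqv_res; rewrite ?const_int_ext.
rewrite formula_int_And lexI; apply/andP.
split; apply/le_atomic_int_Eq; split; rewrite ?term_ext_Var ?lex1 //.
  by rewrite [term_int _ (Var _) _]/= tcons0; apply: xcst.
rewrite [term_int _ (Var _) _]/= tcons0.
exact: le_eqv_trans xbc (xcst _ xc).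
Qed.

(** * Induction over the derivation of the unnesting *)

Lemma tinit_tsnoc d (Omega : completeHeytingType d) (L : signature Omega) n m
    (ts : 'I_m -> term L n) t : tinit (tsnoc ts t) = ts.
Proof. by apply/funext => i; exact: tsnoc_lift. Qed.

Lemma tlast_tsnoc d (Omega : completeHeytingType d) (L : signature Omega) n m
    (ts : 'I_m -> term L n) t : tlast (tsnoc ts t) = t.
Proof. exact: tsnoc_max. Qed.

Theorem theorem7p6 (d : Order.disp_t) (Omega : completeHeytingType d)
    (L : signature Omega) (n : nat) (phi : atomic L n) (phi_ex : formula L n)
    (Hphi : unnesting phi phi_ex)
    (M : structure L) (a : 'I_n -> M) :
  formula_int M (Atom phi) a = formula_int M phi_ex a.
Proof.
(* The tuple [a] is generalised, since the induction hypotheses are applied to tuples extended by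
   the new variables. The unnested case holds by computation. *)
rewrite [LHS]/=; elim: Hphi a => {n phi phi_ex} //.
- exact: (@atomic_int_const _ _ L M).
- move=> n f ts t psi us _ _ IH a; apply: formula_int_prefixed => //.
  + exact: fun_graph_eqv.
  (* Splitting [us] into [tinit] and [tlast] gives back [ts] and [t], so [reads_fun_l] covers the
     original equation as well as the last conjunct. *)
  + by have := @reads_fun_l _ _ _ M _ f us; rewrite tinit_tsnoc tlast_tsnoc.
  + exact: reads_fun_l.
- move=> n f ts t psi us _ _ IH a; apply: formula_int_prefixed => //.
  + exact: fun_graph_eqv.
  + by have := @reads_fun_r _ _ _ M _ f us; rewrite tinit_tsnoc tlast_tsnoc.
  + exact: reads_fun_r.
- move=> n R ts psi _ _ IH a; apply: formula_int_prefixed => //.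
  + exact: rel_int_eqv.
  + exact: reads_Rel.
  + exact: reads_Rel.
Qed.
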